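(* For every set-indexed family $(f_i:\underline{X}_i\to\underline{Y}_i)_{i\in I}$ of functions between topological spaces, $\operatorname{Lev}^2(\lceil f_i\rceil_{i\in I})=\sup\{\operatorname{Lev}^2(f_i)\mid i\in I\}$.
   Context: For $f:\underline{X}\to\underline{Y}$ define by transfinite recursion $\mathcal{L}^2_0(f)=X$, $\mathcal{L}^2_{\alpha+1}(f)=cl\{x\in\mathcal{L}^2_\alpha(f)\mid f|_{\mathcal{L}^2_\alpha(f)}\text{ is discontinuous at }x\}$ (subspace topology; closure in $X$), and $\mathcal{L}^2_\gamma(f)=cl\bigcap_{\alpha<\gamma}\mathcal{L}^2_\alpha(f)$ for limit $\gamma$. $\operatorname{Lev}^2(f)=\min\{\alpha\mid\mathcal{L}^2_\alpha(f)=\emptyset\}$; if no such $\alpha$ exists the Level is regarded as a value greater than all ordinals (and a supremum involving it equals it). The coproduct $\coprod_i\underline{X}_i=\bigcup_i\{i\}\times X_i$ carries the smallest topology containing all $\{i\}\times U$, $U$ open in $\underline{X}_i$, and $\lceil f_i\rceil_{i\in I}:\coprod_i\underline{X}_i\to\coprod_i\underline{Y}_i$ is $(i,x)\mapsto(i,f_i(x))$. *)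

(* Defs.v *)
From HB Require Import structures.
From mathcomp Require Import all_boot all_classical topology.

Set Implicit Arguments.
Unset Strict Implicit.
Unset Printing Implicit Defensive.

Local Open Scope classical_set_scope.

(* The tree tnode A h denotes the ordinal sup_x (h x + 1); tle and tlt compare
   the denoted ordinals.  The ranks of all well-founded relations on types in
   the universe of A are obtained in this way, and in particular all ordinals
   that can be the level of a function on such a type. *)
Inductive tree : Type := tnode (A : Type) of (A -> tree).

Fixpoint tle (a b : tree) : Prop :=
  match a, b with
  | @tnode A f, @tnode B g => forall x : A, exists y : B, tle (f x) (g y)
  end.

Definition tlt (a b : tree) : Prop :=
  match b with @tnode B g => exists y : B, tle a (g y) end.

Definition teq (a b : tree) : Prop := tle a b /\ tle b a.

Lemma tle_refl a : tle a a.
Proof. by elim: a => A f IH /= x; exists x. Qed.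

Lemma tle_trans a b c : tle a b -> tle b c -> tle a c.
Proof.
elim: a b c => A f IH [B g] [C h] /= ab bc x.
have [y xy] := ab x; have [z yz] := bc y.
by exists z; apply: IH xy yz.
Qed.

Lemma tle_lt_trans a b c : tle a b -> tlt b c -> tlt a c.
Proof. by case: c => C h ab [z bz]; exists z; apply: tle_trans bz. Qed.

Lemma tlt_le_trans a b c : tlt a b -> tle b c -> tlt a c.
Proof.
case: b c => [B g] [C h] [y ay] /(_ y)[z yz].
by exists z; apply: tle_trans yz.
Qed.

Lemma tle_lt_total a b : tle a b \/ tlt b a.
Proof.
elim: a b => A f IH [B g]; have [|nle] := pselect (tle (tnode f) (tnode g)).
  by left.
right; move: nle => /= /existsNP[x /forallNP nx]; exists x.
have lt y : tlt (g y) (f x) by case: (IH x (g y)) => // /nx.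
by case: (f x) lt.
Qed.

Lemma tltW a b : tlt a b -> tle a b.
Proof.
suff H c : match c with @tnode C h => forall z, tle (h z) c end.
  by case: b => B g [y ay]; apply: tle_trans ay (H (tnode g) y).
elim: c => C h IH z.
have := IH z; case E : (h z) => [D k] /= Hk w.
by exists z; rewrite E; apply: Hk.
Qed.

Lemma tlt_wf : well_founded tlt.
Proof.
suff H a b : tle b a -> Acc tlt b by move=> a; apply: H (tle_refl a).
elim: a b => A f IH b ba; constructor => c cb.
by have [x] := tlt_le_trans cb ba; apply: IH.
Qed.

Lemma tlt_irrefl a : ~ tlt a a.
Proof. by elim/(well_founded_ind tlt_wf): a => a IH aa; apply: (IH a). Qed.

(* An ordinal is an equivalence class of trees denoting the same ordinal, so
   that Leibniz equality on Ord is equality of ordinals. *)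
Record Ord : Type := MkOrd {
  ocls : tree -> Prop ;
  ocls_ex : exists a, ocls = teq a }.

Definition oclass (a : tree) : Ord := MkOrd (ex_intro _ a erefl).

Definition orepr (a : Ord) : tree := sval (cid (ocls_ex a)).

Definition ole (a b : Ord) : Prop := tle (orepr a) (orepr b).

Definition olt (a b : Ord) : Prop := tlt (orepr a) (orepr b).

Lemma orepr_class t : teq (orepr (oclass t)) t.
Proof.
rewrite /orepr; case: cid => s /= E; rewrite -E; split; exact: tle_refl.
Qed.

Lemma ole_anti a b : ole a b -> ole b a -> a = b.
Proof.
rewrite /ole /orepr; case: cid; case: cid.
case: a b => [P hP] [Q hQ] /= s EQ t EP ts st.
suff PQ : P = Q by move: hP hQ; rewrite PQ => hP hQ; congr MkOrd.
rewrite EP EQ; apply/funext => u; apply/propext; split=> -[xu ux]; split;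
  by [apply: tle_trans xu | apply: tle_trans ux _].
Qed.

Lemma ole_refl a : ole a a.
Proof. exact: tle_refl. Qed.

Lemma ole_trans b a c : ole a b -> ole b c -> ole a c.
Proof. exact: tle_trans. Qed.

Lemma ole_lt_trans b a c : ole a b -> olt b c -> olt a c.
Proof. exact: tle_lt_trans. Qed.

Lemma olt_le_trans b a c : olt a b -> ole b c -> olt a c.
Proof. exact: tlt_le_trans. Qed.

Lemma ole_lt_total a b : ole a b \/ olt b a.
Proof. exact: tle_lt_total. Qed.

Lemma oltW a b : olt a b -> ole a b.
Proof. exact: tltW. Qed.

Lemma olt_irrefl a : ~ olt a a.
Proof. exact: tlt_irrefl. Qed.

Lemma olt_wf : well_founded olt.
Proof.
suff H t a : orepr a = t -> Acc olt a by move=> a; exact: H.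
elim/(well_founded_ind tlt_wf): t a => t IH a E; constructor => b ba.
by apply: (IH (orepr b)) => //; rewrite -E.
Qed.

Lemma ord_least_ex (P : Ord -> Prop) :
  (exists a, P a) -> exists a, P a /\ forall b, P b -> ole a b.
Proof.
case; elim/(well_founded_ind olt_wf) => a IH Pa.
have [[b [ba Pb]]|nb] := pselect (exists b, olt b a /\ P b).
  exact: IH Pb.
by exists a; split=> // b Pb; case: (ole_lt_total a b) => // ba; case: nb; exists b.
Qed.

Definition ozero : Ord :=
  oclass (tnode (fun x : Empty_set => match x with end)).

Definition osucc (a : Ord) : Ord := oclass (tnode (fun _ : unit => orepr a)).

Definition olimit (a : Ord) : Prop := a <> ozero /\ forall b, a <> osucc b.

Lemma ozero_le a : ole ozero a.
Proof. by apply: tle_trans (orepr_class _).1 _ => /=; case: (orepr a). Qed.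

Lemma olt_osucc a b : olt b (osucc a) <-> ole b a.
Proof.
have [h1 h2] := orepr_class (tnode (fun _ : unit => orepr a)).
split=> [ba|ba]; first by have [_] := tlt_le_trans ba h1.
by apply: tlt_le_trans h2; exists tt.
Qed.

Lemma osucc_inj : injective osucc.
Proof.
by move=> a b e; apply: ole_anti; apply/olt_osucc; [rewrite -e|rewrite e];
  apply/olt_osucc; exact: ole_refl.
Qed.

Lemma osucc_neq0 a : osucc a <> ozero.
Proof.
move=> e; have : olt a ozero by rewrite -e; apply/olt_osucc; exact: ole_refl.
by move=> h; apply: (@olt_irrefl a); apply: olt_le_trans h (ozero_le a).
Qed.

Inductive level : Type := Fin of Ord | Infty.

Definition lle (u v : level) : Prop :=
  match u, v with
  | Fin a, Fin b => ole a b
  | _, Infty => True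
  | Infty, Fin _ => False
  end.

Definition is_lsup (I : Type) (u : I -> level) (s : level) : Prop :=
  (forall i, lle (u i) s) /\ (forall t, (forall i, lle (u i) t) -> lle s t).

Lemma lle_anti u v : lle u v -> lle v u -> u = v.
Proof. by case: u v => [a|] [b|] //= ab ba; rewrite (ole_anti ab ba). Qed.

Lemma ord_bounded (I : Type) (u : I -> Ord) : exists b, forall i, ole (u i) b.
Proof.
exists (oclass (tnode (fun i => orepr (u i)))) => i; apply: tltW.
by apply: tlt_le_trans (orepr_class _).2; exists i; exact: tle_refl.
Qed.

Lemma lsup_ex (I : Type) (u : I -> level) : exists s, is_lsup u s.
Proof.
have [[i ui]|nu] := pselect (exists i, u i = Infty).
  exists Infty; split=> [j|t /(_ i)]; last by rewrite ui; case: t.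
  by case: (u j).
have hu i : exists a, u i = Fin a.
  by case E : (u i) => [a|]; [exists a | case: nu; exists i].
have [|s [su sl]] := @ord_least_ex (fun b => forall i, lle (u i) (Fin b)).
  have [b ub] := ord_bounded (fun i => sval (cid (hu i))).
  by exists b => i; have := ub i; case: cid => a /= ->.
exists (Fin s); split=> // -[b|//]; exact: sl.
Qed.

Definition lsup (I : Type) (u : I -> level) : level := sval (cid (lsup_ex u)).

Lemma lsupP (I : Type) (u : I -> level) : is_lsup u (lsup u).
Proof. by rewrite /lsup; case: cid. Qed.

Section Level2.
Variables (X Y : topologicalType) (f : X -> Y).

Definition discontinuity (A : set X) : set X :=
  [set x | A x /\ ~ {for (x : subspace A), continuous (from_subspace A f)}].

Definition L2_step (a : Ord) (L : forall b, olt b a -> set X) : set X :=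
  [set x | [\/ a = ozero,
     exists b (ba : olt b a),
       a = osucc b /\ closure (discontinuity (L b ba)) x
   | olimit a /\ closure [set y | forall b (ba : olt b a), L b ba y] x]].

Definition L2 : Ord -> set X := Fix olt_wf (fun _ => set X) L2_step.

Lemma L2E a : L2 a = L2_step (fun b (_ : olt b a) => L2 b).
Proof.
rewrite /L2 Fix_eq// => {}a L L' LL'; congr L2_step.
by apply/functional_extensionality_dep => b; apply/funext => ba; exact: LL'.
Qed.

Lemma L2_zero : L2 ozero = setT.
Proof. by rewrite L2E; apply/seteqP; split=> // x _; constructor. Qed.

Lemma L2_succ a : L2 (osucc a) = closure (discontinuity (L2 a)).
Proof.
rewrite L2E; apply/seteqP; split=> x /=.
  case=> [/osucc_neq0//|[b [_ [/osucc_inj <-]]]//|[[_ /(_ a)]]//].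
by move=> cx; constructor 2; exists a; (unshelve eexists) => //;
  apply/olt_osucc; exact: ole_refl.
Qed.

Lemma L2_limit a : olimit a ->
  L2 a = closure [set x | forall b, olt b a -> L2 b x].
Proof.
move=> la; rewrite L2E; apply/seteqP; split=> x /= cx; last by constructor 3.
by case: la cx => a0 aS [/a0//|[b [_ [/aS]]]//|[]].
Qed.

Definition Lev2 : level :=
  match pselect (exists a, L2 a = set0) with
  | left h => Fin (sval (cid (ord_least_ex h)))
  | right _ => Infty
  end.

End Level2.

Definition coprod_map (I : Type) (X Y : I -> Type) (f : forall i, X i -> Y i)
    (z : {i & X i}) : {i & Y i} :=
  existT Y (projT1 z) (f (projT1 z) (projT2 z)).

(* The library topology on {i & X i} makes U open iff every section of U is
   open; with existT_open_map, this shows that it is the smallest topology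
   containing all existT X i @` V, V open. *)
Lemma sigT_open_smallest (I : choiceType) (X : I -> topologicalType)
    (T : set (set {i & X i})) :
  (forall (J : Type) (F : J -> set {i & X i}),
     (forall j, T (F j)) -> T (\bigcup_j F j)) ->
  (forall i (V : set (X i)), open V -> T (existT X i @` V)) ->
  forall U : set {i & X i}, open U -> T U.
Proof.
move=> TU TV U /sigT_openP oU.
have -> : U = \bigcup_i (existT X i @` (existT X i @^-1` U)).
  apply/seteqP; split=> [[i x] Ux|z [i _ [x Ux <-]]//].
  by exists i => //; exists x.
by apply: TU => i; exact: TV.
Qed.

(* Main.v *)
Require Import Defs.
From mathcomp Require Import all_boot all_classical topology.

Set Implicit Arguments.
Unset Strict Implicit.
Unset Printing Implicit Defensive.

Local Open Scope classical_set_scope.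

(** All the constructions in the recursion are local, and each summand is open
    in the coproduct; so [L2] of the coproduct map is, summand by summand, [L2]
    of the maps [f i].  Since [L2] stays empty once it is empty, a level is at
    most [a] exactly when [L2] is empty at [a], and the two sides of the
    theorem have the same upper bounds. *)

Section Coproduct.
Variables (I : choiceType) (X : I -> topologicalType).

Lemma nbhs_existT i (x : X i) (U : set {i & X i}) :
  nbhs (existT X i x) U <-> nbhs x (existT X i @^-1` U).
Proof. by []. Qed.

(** Both inclusions transport neighbourhoods: the image under [existT X i] of a neighbourhood is
    again one because the summand is open, and preimages of neighbourhoods are neighbourhoods by
    definition of the topology. *)
Lemma closure_existT i (A : set {i & X i}) :
  existT X i @^-1` closure A = closure (existT X i @^-1` A).
Proof.
apply/seteqP; split=> x /= cx B.
  move=> /existT_nbhs /cx[z [Az [y By yz]]].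
  by exists y; split=> //=; rewrite yz.
by move=> /nbhs_existT /cx[y [Ay By]]; exists (existT X i y).
Qed.

End Coproduct.

(** Trades the topology of [subspace A] for neighbourhoods in [X], which transfer between a summand
    and the coproduct. *)
Lemma subspace_continuous_forP (X Y : topologicalType) (f : X -> Y)
    (A : set X) x : A x ->
  {for (x : subspace A), continuous (from_subspace A f)} <->
  forall V, nbhs (f x) V -> nbhs x [set y | A y -> V (f y)].
Proof.
move=> Ax; rewrite /prop_for /continuous_at /from_subspace.
by rewrite /nbhs /= -nbhs_subspace_in//; split=> h V /h.
Qed.

Lemma discontinuity_existT (I : choiceType) (X Y : I -> topologicalType)
    (f : forall i, X i -> Y i) i (A : set {i & X i}) :
  existT X i @^-1`
    discontinuity (coprod_map f : {i & X i} -> {i & Y i}) A =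
  discontinuity (f i) (existT X i @^-1` A).
Proof.
apply/seteqP; split=> x -[/= Ax dx]; split=> //; apply: contra_not dx.
  move=> /subspace_continuous_forP h; apply/subspace_continuous_forP => // V.
  by move=> /nbhs_existT /h-/(_ Ax) hV; apply/nbhs_existT.
move=> /subspace_continuous_forP h; apply/subspace_continuous_forP => // V hV.
have /nbhs_existT := h Ax _ (existT_nbhs _ _ _ hV); apply: filterS => y /= Vy Ay.
(* Two points of the coproduct with the same tag [i] are equal only if their second components
   are. *)
by have [z Vz /(@eq_from_Tagged _ _ _ _ _) <-] := Vy Ay.
Qed.

Lemma ord_caseP a : [\/ a = ozero, exists b, a = osucc b | olimit a].
Proof.
have [->|a0] := pselect (a = ozero); first by constructor 1.
have [ab|nb] := pselect (exists b, a = osucc b); first by constructor 2.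
by constructor 3; split=> // b ab; apply: nb; exists b.
Qed.

(** By transfinite induction: taking a section commutes with closure, with discontinuity sets and
    with intersections. *)
Lemma L2_coprod (I : choiceType) (X Y : I -> topologicalType)
    (f : forall i, X i -> Y i) a i :
  existT X i @^-1` L2 (coprod_map f : {i & X i} -> {i & Y i}) a = L2 (f i) a.
Proof.
elim/(well_founded_ind olt_wf): a => a IH.
have [->|[b ab]|la] := ord_caseP a; first by rewrite !L2_zero.
- rewrite ab !L2_succ closure_existT discontinuity_existT IH// ab.
  by apply/olt_osucc; exact: ole_refl.
- rewrite !L2_limit// closure_existT; congr closure.
  by apply/seteqP; split=> x /= h b ba; have := h b ba; rewrite -IH.
Qed.

Section Level.
Variables (X Y : topologicalType) (f : X -> Y).

(** For [b] above [a]: if [b] is the successor of [c], then [a] is at most [c] and the induction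
    hypothesis empties stage [c]; if [b] is a limit, stage [a] is among the sets intersected. *)
Lemma L2_eq0_le a b : ole a b -> L2 f a = set0 -> L2 f b = set0.
Proof.
move=> + a0; elim/(well_founded_ind olt_wf): b => b IH ab.
have [ba|lt_ab] := ole_lt_total b a; first by rewrite -(ole_anti ab ba).
have [b0|[c bc]|lb] := ord_caseP b.
- by case: (@olt_irrefl a); apply: olt_le_trans lt_ab _; rewrite b0; exact: ozero_le.
- rewrite bc L2_succ IH ?bc; [|by apply/olt_osucc; exact: ole_refl|].
    by rewrite (_ : discontinuity _ _ = set0) ?closure0//; apply/seteqP; split=> x [].
  by apply/olt_osucc; rewrite -bc.
- rewrite L2_limit// (_ : mkset _ = set0) ?closure0//.
  by apply/seteqP; split=> x //= /(_ _ lt_ab); rewrite a0.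
Qed.

Lemma Lev2_leP a : lle (Lev2 f) (Fin a) <-> L2 f a = set0.
Proof.
rewrite /Lev2; case: pselect => [h|nh]; last by split=> // a0; case: nh; exists a.
case: cid => b [b0 bmin] /=; split=> [ba|]; last exact: bmin.
exact: L2_eq0_le b0.
Qed.

End Level.

Theorem theorem5p14 (I : choiceType) (X Y : I -> topologicalType)
    (f : forall i, X i -> Y i) :
  Lev2 (coprod_map f : {i & X i} -> {i & Y i}) = lsup (fun i => Lev2 (f i)).
Proof.
set g := (coprod_map f : {i & X i} -> {i & Y i}).
have ubP t : lle (Lev2 g) t <-> forall i, lle (Lev2 (f i)) t.
  case: t => [a|]; last by split=> [_ i|_]; [case: (Lev2 (f i))|case: (Lev2 g)].
  rewrite Lev2_leP; split=> [g0 i|f0].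
    by apply/Lev2_leP; rewrite -L2_coprod -/g g0 preimage_set0.
  (* Every point of the coproduct lies in some summand, whose section at stage [a] is empty. *)
  apply/seteqP; split=> [[i x] gx|//].
  have /Lev2_leP fi0 := f0 i.
  by have : L2 (f i) a x; [rewrite -L2_coprod|rewrite fi0].
have lle_refl u : lle u u by case: u => [a|] //; exact: ole_refl.
have [ub least] := lsupP (fun i => Lev2 (f i)).
(* [ubP] is used at the supremum and then, with reflexivity, at [Lev2 g] itself. *)
by apply: lle_anti; [apply/ubP | apply: least; apply/ubP].
Qed.
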